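(* Every $2$-connected $\{K_{1,3}^{**},Z_1\}$-free graph has a longest cycle which is a dominating cycle of the graph.
   Context: All graphs are finite and simple. A cycle $C$ in a graph $G$ is dominating if every edge of $G$ has at least one end vertex on $C$. $G$ is $\{K_{1,3}^{**},Z_1\}$-free if it contains neither graph as an induced subgraph. $K_{1,3}^{*}$ is the graph obtained from the claw $K_{1,3}$ by subdividing each edge once, and $K_{1,3}^{**}$ is obtained from $K_{1,3}^{*}$ by deleting one vertex of degree $1$ (so it has a center with three neighbors, two of which carry a further pendant vertex). $Z_1$ is a triangle with one pendant vertex attached. *)

(* Defs.v *)
From mathcomp Require Import all_boot.

Set Implicit Arguments.
Unset Strict Implicit.
Unset Printing Implicit Defensive.

Record sgraph := SGraph {
  vertex :> finType;
  adj : rel vertex;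
  adj_sym : symmetric adj;
  adj_irrefl : irreflexive adj }.

Section Induced.
Variables (G : sgraph) (A : {set G}).

Let ind_adj : rel {x : G | x \in A} := [rel x y | adj (val x) (val y)].

Fact ind_adj_sym : symmetric ind_adj.
Proof. by move=> x y; rewrite /ind_adj /= adj_sym. Qed.

Fact ind_adj_irrefl : irreflexive ind_adj.
Proof. by move=> x; rewrite /ind_adj /= adj_irrefl. Qed.

Definition induced : sgraph := SGraph ind_adj_sym ind_adj_irrefl.

End Induced.

Definition isomorphic (G H : sgraph) : Prop :=
  exists2 f : G -> H, bijective f & forall x y, adj (f x) (f y) = adj x y.

Definition free_of (H G : sgraph) : Prop :=
  ~ exists A : {set G}, isomorphic (induced A) H.

Definition connected (G : sgraph) : Prop :=
  0 < #|G| /\ forall x y : G, connect (@adj G) x y.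

Definition k_connected (k : nat) (G : sgraph) : Prop :=
  k < #|G| /\ forall X : {set G}, #|X| < k -> connected (induced (~: X)).

(* A cycle is given by the list of its vertices in cyclic order; the size bound
   is needed because [ucycle] also accepts the empty list and, for a symmetric
   relation, the two ends of an edge. The size is the length of the cycle. *)
Definition is_cycle (G : sgraph) (c : seq G) : Prop :=
  2 < size c /\ ucycle (@adj G) c.

Definition longest_cycle (G : sgraph) (c : seq G) : Prop :=
  is_cycle c /\ forall c' : seq G, is_cycle c' -> size c' <= size c.

Definition dominating_cycle (G : sgraph) (c : seq G) : Prop :=
  is_cycle c /\ forall x y : G, adj x y -> (x \in c) || (y \in c).

Section EdgeList.
Variables (n : nat) (E : seq (nat * nat)).

Let list_adj : rel 'I_n :=
  [rel i j | (i != j) &&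
     (((val i, val j) \in E) || ((val j, val i) \in E))].

Fact list_adj_sym : symmetric list_adj.
Proof. by move=> i j; rewrite /list_adj /= eq_sym orbC. Qed.

Fact list_adj_irrefl : irreflexive list_adj.
Proof. by move=> i; rewrite /list_adj /= eqxx. Qed.

Definition graph_of_edges : sgraph := SGraph list_adj_sym list_adj_irrefl.

End EdgeList.

(* The claw with each edge subdivided once: 0 is the centre, 1, 2, 3 are the
   subdivision vertices and 4, 5, 6 the leaves of the claw. *)
Definition K13_star : sgraph :=
  graph_of_edges 7 [:: (0, 1); (0, 2); (0, 3); (1, 4); (2, 5); (3, 6)].

Definition K13_starstar : sgraph :=
  graph_of_edges 6 [:: (0, 1); (0, 2); (0, 3); (1, 4); (2, 5)].

Fact K13_starstarP :
  isomorphic (induced [set i : K13_star | i != 6 :> nat]) K13_starstar.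
Proof.
pose A := [set i : K13_star | i != 6 :> nat].
have lt6 (x : induced A) : val x < 6.
  by case: x => -[m lt_m7] /=; rewrite inE /= ltn_neqAle -ltnS lt_m7 => ->.
have inA (i : K13_starstar) : widen_ord (leqnSn 6) i \in A.
  by rewrite inE /= neq_ltn ltn_ord.
exists (fun x : induced A => Ordinal (lt6 x) : K13_starstar).
  exists (fun i : K13_starstar => exist _ (widen_ord (leqnSn 6) i) (inA i)).
    by move=> x; do 2!apply: val_inj.
  by move=> i; apply: val_inj.
move=> x y; move: (lt6 x) (lt6 y); case: x y => [[i lti] Ai] [[j ltj] Aj] /=.
by case: i lti Ai => [|[|[|[|[|[|]]]]]] // lti Ai;
   case: j ltj Aj => [|[|[|[|[|[|]]]]]].
Qed.

Definition Z1 : sgraph :=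
  graph_of_edges 4 [:: (0, 1); (1, 2); (0, 2); (2, 3)].

(* Main.v *)
Require Import Defs.
From mathcomp Require Import all_boot zify.

(* In fact every longest cycle C dominates. If G has a triangle, then, G being
   connected and Z1-free, every vertex is adjacent to an end of every edge, and
   an edge off C can be inserted between two consecutive vertices of C.

   If G is triangle-free, an edge off C yields by 2-connectedness a vertex u off
   C adjacent to some x in C and a path off C from u to some y <> x in C. Follow
   C from x in both directions towards the nearest vertices reachable from u in
   this way. Being free of K13_starstar forces consecutive distance layers from
   x, restricted to these two arcs, to be completely joined. Hence the parts of
   the two arcs inside the first two layers can be traversed one after the
   other, and only shorter arcs remain to be treated; once an arc is exhausted,
   a cycle longer than C appears. *)

Set Implicit Arguments.
Unset Strict Implicit.
Unset Printing Implicit Defensive.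

(** * Embedded induced subgraphs and list splitting *)

Lemma free_of_embedding (H G : sgraph) (f : H -> G) :
    free_of H G -> injective f -> ~ (forall x y, adj (f x) (f y) = adj x y).
Proof.
move=> freeHG f_inj f_adj; apply: freeHG; exists [set f x | x in H].
have fP (y : induced [set f x | x in H]) : exists x, f x == val y.
  by case: y => y /= /imsetP[x _ ->]; exists x.
pose g y := xchoose (fP y).
have gK y : f (g y) = val y by exact/eqP/(xchooseP (fP y)).
exists g; last by move=> x y; rewrite -f_adj !gK.
have fin x : f x \in [set f x | x in H] by apply: imset_f.
exists (fun x => exist _ (f x) (fin x)) => x; first by apply: val_inj => /=.
by apply: f_inj; rewrite gK.
Qed.

Lemma split_first (T : Type) (P : pred T) (s : seq T) :
  has P s -> exists s1 x s2, [/\ s = s1 ++ x :: s2, P x & ~~ has P s1].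
Proof.
elim: s => //= x s IHs; have [Px _|nPx /= /IHs[s1 [y [s2 [-> Py nPs1]]]]] := boolP (P x).
  by exists [::], x, s.
by exists (x :: s1), y, s2; split; rewrite //= (negPf nPx).
Qed.

Lemma split_last (T : Type) (P : pred T) (s : seq T) :
  has P s -> exists s1 x s2, [/\ s = s1 ++ x :: s2, P x & ~~ has P s2].
Proof.
rewrite -has_rev => /split_first[s1 [x [s2 [Es Px nPs1]]]].
exists (rev s2), x, (rev s1); split; rewrite ?has_rev //.
by rewrite -[s]revK Es rev_cat rev_cons cat_rcons.
Qed.

Lemma cycle_catC (T : Type) (e : rel T) (s1 s2 : seq T) :
  cycle e (s1 ++ s2) = cycle e (s2 ++ s1).
Proof. by rewrite -rot_size_cat rot_cycle. Qed.

Local Ltac size_lia := do 6 rewrite ?(size_cat, size_rev, size_rcons) /=; clear; lia.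

Local Ltac perm_lia :=
  apply/permP => ?; do 6 rewrite -?cats1 ?(count_cat, count_rev) /=; clear; lia.

Local Ltac path_auto :=
  do 6 rewrite ?(rcons_cat, cat_path, last_cat, rcons_path, last_rcons) /=; intros;
  repeat match goal with
    H : is_true (_ && _) |- _ => let H1 := fresh in let H2 := fresh in case/andP: H => H1 H2
  end;
  repeat (apply/andP; split); try assumption.

(** * Local consequences of the forbidden subgraphs *)

Section Graph.

Variable G : sgraph.
Implicit Types (x y z u v w : G) (s c F A B Q T : seq G).

Lemma adj_neq x y : adj x y -> x != y.
Proof. by apply: contraTneq => ->; rewrite adj_irrefl. Qed.

Lemma paw_free (a b c d : G) : free_of Z1 G ->
  adj a b -> adj b c -> adj a c -> adj c d -> adj a d || adj b d.
Proof.
move=> freeG ab bc ac cd; apply: contraT; rewrite negb_or => /andP[nad nbd].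
pose f (i : Z1) := nth a [:: a; b; c; d] i.
have f_adj i j : adj (f i) (f j) = adj i j.
  have adjC := @adj_sym G.
  case: i j => [[|[|[|[|]]]] // ?] [[|[|[|[|]]]] // ?]; rewrite /f /= ?adj_irrefl //;
    by [apply: negbTE | rewrite adjC | apply: negbTE; rewrite adjC].
(* Injectivity follows from [f_adj]: no two vertices of [Z1] have the same neighbours, and testing
   against 0, 1, 2 tells them all apart. *)
case: (@free_of_embedding _ _ f freeG _ f_adj) => i j fij.
have adjE k : adj i k = adj j k by rewrite -!f_adj fij.
apply: val_inj; move: (adjE ord0) (adjE (inord 1)) (adjE (inord 2)).
rewrite /adj /= -!val_eqE /= !inordK //.
by case: i j {fij adjE} => [[|[|[|[|]]]] // ?] [[|[|[|[|]]]] // ?].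
Qed.

Definition triangle_free := forall x y z, adj x y -> adj y z -> ~~ adj x z.

(** The disjuncts are the chords that triangle-freeness does not exclude. They also cover
    coincidences: if [a = b], for instance, then [adj a' b]. *)
Lemma spider_free (z a b l a' b' : G) :
    free_of K13_starstar G -> triangle_free ->
    adj z a -> adj z b -> adj z l -> adj a a' -> adj b b' ->
  [|| adj a' b, adj a' l, adj b' a, adj b' l | adj a' b'].
Proof.
move=> freeG tri za zb zl aa bb; apply: contraT; rewrite !negb_or.
case/and5P=> na'b na'l nb'a nb'l na'b'.
have adjC := @adj_sym G.
have nza' := tri _ _ _ za aa; have nzb' := tri _ _ _ zb bb.
have [az bz] : adj a z /\ adj b z by rewrite ![adj _ z]adjC.
have nab := tri _ _ _ az zb; have nal := tri _ _ _ az zl; have nbl := tri _ _ _ bz zl.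
pose f (i : K13_starstar) := nth z [:: z; a; b; l; a'; b'] i.
have f_adj i j : adj (f i) (f j) = adj i j.
  case: i j => [[|[|[|[|[|[|]]]]]] // ?] [[|[|[|[|[|[|]]]]]] // ?];
    rewrite /f /= ?adj_irrefl //;
    by [apply: negbTE | rewrite adjC | apply: negbTE; rewrite adjC].
case: (@free_of_embedding _ _ f freeG _ f_adj) => i j fij.
have adjE k : adj i k = adj j k by rewrite -!f_adj fij.
apply: val_inj; move: (adjE (inord 1)) (adjE (inord 2)) (adjE (inord 4)) (adjE (inord 5)).
rewrite /adj /= -!val_eqE /= !inordK //.
by case: i j {fij adjE} => [[|[|[|[|[|[|]]]]]] // ?] [[|[|[|[|[|[|]]]]]] // ?].
Qed.

Lemma rev_cycle_adj c : cycle (@adj G) (rev c) = cycle (@adj G) c.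
Proof.
by rewrite rev_cycle; apply: eq_cycle => x y; rewrite adj_sym.
Qed.

Lemma path_rcons_sym x y s :
  path (@adj G) x (rcons s y) = path (@adj G) y (rcons (rev s) x).
Proof.
rewrite -rev_cons -(belast_rcons x s y) -{2}(last_rcons x s y) rev_path.
by apply: eq_path => u v; rewrite adj_sym.
Qed.

(** * Paths off a given set *)

Definition adj_off F : rel G := [rel x y | adj x y && (y \notin F)].

(* [u] and [w] are joined by a path with at least one inner vertex, all of whose
   inner vertices lie outside [F]. *)
Definition link F u w :=
  [exists v, [exists t,
     [&& adj u v, v \notin F, connect (adj_off F) v t & adj t w]]].

Lemma linkP F u w : reflect
  (exists v s, [/\ path (@adj G) u (v :: s), adj (last v s) w, uniq (v :: s)
                 & ~~ has (mem F) (v :: s)])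
  (link F u w).
Proof.
apply: (iffP existsP) => [[v /existsP[t /and4P[uv Fv /connectP[s0 p_s0 ->]]]]|].
  case/shortenP: p_s0 => s p_s us _ tw; exists v, s; split=> //=.
    by rewrite uv (sub_path _ p_s) // => x y /andP[].
  rewrite (negPf Fv) /=; elim: s v p_s {uv Fv us tw} => //= x s IHs v.
  by case/andP=> /andP[_ /negPf->]; apply: IHs.
case=> v [s [/= /andP[uv p_s] tw _ /norP[Fv Fs]]].
exists v; apply/existsP; exists (last v s); rewrite uv Fv tw andbT /=.
apply/connectP; exists s => //; elim: s v p_s Fs {uv Fv tw} => //= x s IHs v.
by case/andP=> vx p_s /norP[Fx Fs]; rewrite IHs // andbT; apply/andP.
Qed.

Lemma eq_link F F' u w : F =i F' -> link F u w = link F' u w.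
Proof.
move=> eqF; have eqoff : adj_off F =2 adj_off F' by move=> x y; rewrite /adj_off /= eqF.
by apply: eq_existsb => v; apply: eq_existsb => t; rewrite (eq_connect eqoff) eqF.
Qed.

(** * Theta configurations *)

Section Circumference.

Variable m : nat.
Hypothesis m_gt2 : 2 < m.
Hypothesis cycle_le : forall c, is_cycle c -> size c <= m.

(** The form in which maximality is used: [F] lists the available vertices, [c] is the candidate
    cycle and [r] what it leaves out. *)
Lemma no_long_cycle c r F :
  perm_eq F (c ++ r) -> uniq F -> m + size r < size F -> ~~ cycle (@adj G) c.
Proof.
move=> eqF; rewrite (perm_uniq eqF) (perm_size eqF) cat_uniq size_cat.
rewrite ltn_add2r => /andP[uc _] ltm; apply/negP => cyc_c.
have c_cycle : is_cycle c by split; [apply: ltn_trans ltm | rewrite /ucycle cyc_c].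
by have := cycle_le c_cycle; rewrite leqNgt ltm.
Qed.

(* The cycle is read as: [z], an arc [A], a segment [Q], an arc [B] back to [z].
   The path [T] starts at [z] off this cycle, and from its end both ends of [Q]
   can be reached through new vertices. Every cycle has length at most [m], but
   the configuration has more than [m] vertices. *)
Record theta z A Q B T : Prop := Theta {
  theta_uniq : uniq (z :: A ++ Q ++ B ++ T);
  theta_size : m < size (z :: A ++ Q ++ B ++ T);
  theta_cycle : cycle (@adj G) (z :: A ++ Q ++ B);
  theta_path : path (@adj G) z T;
  theta_nil : Q != [::];
  theta_head : link (z :: A ++ Q ++ B ++ T) (last z T) (head z Q);
  theta_last : link (z :: A ++ Q ++ B ++ T) (last z T) (last z Q) }.

Lemma theta_rev z A Q B T : theta z A Q B T -> theta z (rev B) (rev Q) (rev A) T.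
Proof.
case=> Fu Fs cyc pT Q0 hQ lQ.
have eqF : perm_eq (z :: rev B ++ rev Q ++ rev A ++ T) (z :: A ++ Q ++ B ++ T).
  by perm_lia.
have hd : head z (rev Q) = last z Q by case/lastP: (Q) => // s x; rewrite rev_rcons last_rcons.
have lt : last z (rev Q) = head z Q by case: (Q) => // x s; rewrite rev_cons last_rcons.
split; rewrite ?(perm_uniq eqF) ?(perm_size eqF) ?hd ?lt ?(eq_link _ _ (perm_mem eqF)) //.
  by rewrite -cat1s cycle_catC -rev_cycle_adj !rev_cat !revK -!catA.
by rewrite -size_eq0 size_rev size_eq0.
Qed.

(* Otherwise [T], followed by a link to the head of [Q], replaces [A] in the cycle. *)
Lemma theta_arc z A Q B T : theta z A Q B T -> 1 < size A.
Proof.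
case=> Fu Fs cyc pT; case: Q cyc Fu Fs => // y Q cyc Fu Fs _ /linkP[v [s [p_s sy us Fsn]]] _.
rewrite ltnNge; apply/negP => A1.
pose F := (z :: A ++ (y :: Q) ++ B ++ T) ++ v :: s.
have Funiq : uniq F by rewrite cat_uniq Fu Fsn us.
have /negP[] : ~~ cycle (@adj G) (z :: T ++ (v :: s) ++ (y :: Q) ++ B).
  apply: (@no_long_cycle _ A F) => //; last first.
    by move: Fs A1; rewrite /F; size_lia.
  by rewrite /F; perm_lia.
by move: cyc p_s sy pT; path_auto.
Qed.

(* With the edge from [x] to [b] a cycle can use [T], a link to the head of [Q],
   and all of the configuration but [r]. *)
Lemma theta_bridge z A' x r Q B b T :
  theta z (rcons A' x ++ r) Q (rcons B b) T -> size r <= 1 -> ~~ adj x b.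
Proof.
move=> th r1; apply/negP => xb; case: th => Fu Fs cyc pT.
case: Q cyc Fu Fs => // y Q cyc Fu Fs _ /linkP[v [s [p_s sy us Fsn]]] _.
pose F := (z :: (rcons A' x ++ r) ++ (y :: Q) ++ rcons B b ++ T) ++ v :: s.
have Funiq : uniq F by rewrite cat_uniq Fu Fsn us.
pose C := z :: T ++ (v :: s) ++ (y :: Q) ++ rcons B b ++ rev (rcons A' x).
have /negP[] : ~~ cycle (@adj G) C.
  apply: (@no_long_cycle _ r F) => //; last first.
    by move: Fs r1; rewrite /F; size_lia.
  by rewrite /F /C; perm_lia.
have : path (@adj G) x (rcons (rev A') z).
  by rewrite -path_rcons_sym; move: cyc; path_auto.
by move: cyc p_s sy pT xb; rewrite /C rev_rcons [adj x b]adj_sym; path_auto.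
Qed.

(** * Spiders with a clean tail *)

Hypotheses (triangleG : triangle_free) (spiderG : free_of K13_starstar G).

(* [q - p - z] is a leg of length two for spiders meeting [S]. *)
Definition clean_tail z p q (S : seq G) :=
  [/\ adj z p, adj p q & {in S, forall w, ~~ adj p w && ~~ adj q w}].

Section CleanTail.

Variables (z p q : G) (S : seq G).
Hypothesis tail : clean_tail z p q S.

(** In the spider with centre [z], legs [p - q] and [b - w] and leaf [l], the clean tail leaves
    [l w] as the only possible chord. *)
Lemma tail_twins b l w : b \in S -> l \in S -> w \in S ->
  adj z b -> adj z l -> adj b w -> adj l w.
Proof.
case: tail => zp pq clean Sb Sl Sw zb zl bw.
have := spider_free spiderG triangleG zp zb zl pq bw.
have /andP[_ /negPf->] := clean _ Sb; have /andP[_ /negPf->] := clean _ Sl.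
have /andP[/negPf + /negPf->] := clean _ Sw; rewrite adj_sym => ->.
by rewrite orbF [adj l w]adj_sym.
Qed.

(** Here the spider has centre [b], legs [z - p] and [d - w], and leaf [d']. *)
Lemma tail_layer b d d' w : b \in S -> d \in S -> d' \in S -> w \in S ->
  adj z b -> adj b d -> adj b d' -> adj d w -> ~~ adj z w -> adj d' w.
Proof.
case: tail => zp _ clean Sb Sd Sd' Sw zb bd bd' dw zw.
have bz : adj b z by rewrite adj_sym.
have := spider_free spiderG triangleG bz bd bd' zp dw.
have /andP[/negPf-> _] := clean _ Sd; have /andP[/negPf-> _] := clean _ Sd'.
have /andP[/negPf-> _] := clean _ Sw.
by rewrite adj_sym (negPf zw) orbF [adj d' w]adj_sym.
Qed.

End CleanTail.

(** Otherwise [tail_twins] joins [b] to the last vertex of the arc or to the one before it, which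
    [theta_bridge] forbids. *)
Lemma theta_last_far z p q a A Q b B T :
    theta z (a :: A) Q (rcons B b) T ->
    clean_tail z p q ((a :: A) ++ rcons B b) ->
  ~~ (adj z (last a A) || adj a (last a A)).
Proof.
move=> th tail; have A1 := theta_arc th.
have [za bz] : adj z a /\ adj z b.
  by case: th => _ _ + _ _ _ _; rewrite [adj z b]adj_sym; path_auto.
have twins := tail_twins tail.
have Sa : a \in (a :: A) ++ rcons B b by rewrite mem_head.
have Sb : b \in (a :: A) ++ rcons B b by rewrite mem_cat mem_rcons mem_head orbT.
case/lastP: A => [|A al] // in th tail A1 twins Sa Sb *; rewrite last_rcons.
have Sal : al \in (a :: rcons A al) ++ rcons B b.
  by rewrite mem_cat inE mem_rcons mem_head orbT.
rewrite negb_or; apply/andP; split; apply/negP; last first.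
  move=> aal; have := twins _ _ _ Sa Sb Sal za bz aal.
  rewrite adj_sym; apply/negP; apply: (@theta_bridge z (a :: A) al [::] Q B b T) => //=.
  by rewrite cats0.
move=> zal; case/lastP E : (a :: A) => [|A' x] //.
have EA : a :: rcons A al = rcons A' x ++ [:: al] by rewrite -E -cats1.
have xal : adj al x.
  by case: th => _ _ + _ _ _ _; rewrite EA [adj al x]adj_sym; path_auto.
have Sx : x \in (a :: rcons A al) ++ rcons B b.
  by rewrite EA !mem_cat mem_rcons mem_head.
have ax := twins _ _ _ Sal Sa Sx zal za xal.
have := twins _ _ _ Sa Sb Sx za bz ax; rewrite adj_sym; apply/negP.
by rewrite EA in th; apply: theta_bridge th _.
Qed.

(** Induction on the total length of the two arcs. By [theta_last_far], applied in both directions,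
    the first two layers exhaust neither arc. *)
Lemma theta_absurd z p q A Q B T :
  theta z A Q B T -> clean_tail z p q (A ++ B) -> False.
Proof.
have [n] := ubnP (size (A ++ B)); elim: n => // n IHn in z p q A Q B T *.
rewrite ltnS => le_n th tail.
have A1 := theta_arc th; have := theta_arc (theta_rev th); rewrite size_rev => B1.
case: A => [|a A] // in th tail A1 le_n *.
case/lastP: B => [|B b] // in th tail B1 le_n *.
have farA := theta_last_far th tail.
have [za zb] : adj z a /\ adj z b.
  by case: th => _ _ + _ _ _ _; rewrite [adj z b]adj_sym; path_auto.
set S := _ ++ _ in tail le_n.
have Sa : a \in S by rewrite mem_head.
have Sb : b \in S by rewrite mem_cat mem_rcons mem_head orbT.
have twins := tail_twins tail.
have farB w : w \in S -> adj a w = adj b w.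
  by move=> Sw; apply/idP/idP; apply: twins.
(* By [tail_twins] and [tail_layer], the vertices of [S] near [z] form two layers,
   each joined completely to the next one. We cut both arcs at their last vertex
   in these layers. *)
pose near w := adj z w || adj a w.
have hA : has near (a :: A) by rewrite /= /near za.
have hB : has near (rcons B b) by rewrite has_rcons /near zb.
have [A1' [al [A2 [EA near_al farA2]]]] := split_last hA.
have [B2 [be [B1' [EB near_be farB2]]]] := split_first hB.
case: A2 => [|x A2] in EA farA2.
  have /(congr1 (last z)) := EA; rewrite last_cat /= => Eal.
  by case/negP: farA; rewrite Eal.
case/lastP: B2 => [|B2 y] in EB farB2.
  (* In the reversed configuration [b] plays the role of [a]. *)
  have thr := theta_rev th; rewrite rev_rcons rev_cons in thr.
  have tailr : clean_tail z p q ((b :: rev B) ++ rcons (rev A) a).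
    case: tail => zp pq clean; split=> // w; rewrite -rev_cons -rev_rcons => Sw.
    by apply: clean; move: Sw; rewrite /S !mem_cat !mem_rev orbC.
  have := theta_last_far thr tailr.
  have -> : last b (rev B) = be.
    by rewrite -[LHS]/(last z (b :: rev B)) -rev_rcons EB rev_cons last_rcons.
  have Sbe : be \in S by rewrite /S EB !(mem_cat, mem_head, orbT).
  by rewrite -farB //; apply/negP; rewrite negbK.
have Sal : al \in S by rewrite /S EA !(mem_cat, mem_head, orbT).
have Sx : x \in S by rewrite /S EA !(mem_cat, inE, eqxx, orbT).
have Sbe : be \in S by rewrite /S EB !(mem_cat, mem_head, orbT).
have Sy : y \in S by rewrite /S EB !(mem_cat, mem_rcons, mem_head, orbT).
have /norP[nzx nax] : ~~ near x by case/norP: farA2.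
have /norP[nzy nay] : ~~ near y by move: farA2 farB2; rewrite has_rcons => _ /norP[].
have [alx ybe] : adj al x /\ adj y be.
  by case: th => _ _ + _ _ _ _; rewrite EA EB; path_auto.
(* [al] is in the second layer: were it adjacent to [z], its successor [x] would be adjacent to [a],
   hence [near]. *)
have aal : adj a al.
  case/orP: near_al => // zal; case/negP: nax.
  exact: twins Sal Sa Sx zal za alx.
have abe : adj a be.
  case/orP: near_be => // zbe; case/negP: nay.
  by apply: twins Sbe Sa Sy zbe za _; rewrite adj_sym.
(* This edge closes the new, shorter cycle through [be]. *)
have bex : adj be x by apply: (tail_layer tail Sa Sal Sbe Sx za aal abe alx nzx).
have nab : ~~ adj a b by apply: triangleG zb; rewrite adj_sym.
case/lastP: B1' => [|B1' b'] in EB.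
  by move: EB abe; rewrite cats1 => /rcons_inj[_ <-]; rewrite (negPf nab).
have Eb : b' = b.
  by have /(congr1 (last z)) := EB; rewrite last_cat /= !last_rcons.
have bal : adj b al by rewrite -farB.
have pA : path (@adj G) al (rcons (rev A1') z).
  by case: th => _ _ + _ _ _ _; rewrite -path_rcons_sym EA; path_auto.
(* The cut-off parts are swept into [T']: down [B1' b], across [b al], down [A1'],
   and then [z] and [T]; the path [z - a - be] becomes the new clean tail. *)
pose T' := rcons B1' b ++ rev (rcons A1' al) ++ z :: T.
have eqF : perm_eq (be :: (x :: A2) ++ Q ++ rcons B2 y ++ T')
                   (z :: (a :: A) ++ Q ++ rcons B b ++ T).
  by rewrite EA EB Eb /T'; perm_lia.
apply: (IHn be a z (x :: A2) Q (rcons B2 y) T').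
- by apply: leq_trans le_n; rewrite /S EA EB; size_lia.
- have eqT u : last u T' = last z T by rewrite /T' !last_cat.
  case: th => Fu Fs cyc pT Q0 hQ lQ.
  have Qhead u : head u Q = head z Q by case: (Q) Q0.
  have Qlast u : last u Q = last z Q by case: (Q) Q0.
  split; rewrite ?(perm_uniq eqF) ?(perm_size eqF)
    ?(eq_link _ _ (perm_mem eqF)) ?eqT ?Qhead ?Qlast //.
    by move: cyc; rewrite EA EB Eb; move: bex ybe; path_auto.
  by move: cyc pT bal pA; rewrite EA EB Eb /T' rev_rcons; path_auto.
split; rewrite // 1?adj_sym // => w Aw.
have : ~~ has near ((x :: A2) ++ rcons B2 y) by rewrite has_cat negb_or farA2.
by move/hasPn/(_ w Aw)/norP=> [zw aw]; rewrite aw zw.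
Qed.

(** * A vertex attached to a longest cycle *)

Section Attached.

Variables (c : seq G) (u : G).
Hypotheses (c_cycle : is_cycle c) (size_c : size c = m) (uNc : u \notin c).

Lemma attached_theta z A Q B T : perm_eq (z :: A ++ Q ++ B ++ T) (u :: c) ->
    cycle (@adj G) (z :: A ++ Q ++ B) -> path (@adj G) z T -> last z T = u ->
    Q != [::] -> link (u :: c) u (head z Q) -> link (u :: c) u (last z Q) ->
  theta z A Q B T.
Proof.
move=> eqF cyc pT uT Q0 hQ lQ; have [_ /andP[_ uc]] := c_cycle.
by split; rewrite ?(perm_uniq eqF) ?(perm_size eqF) ?(eq_link _ _ (perm_mem eqF)) ?uT //=;
   rewrite ?uNc ?size_c.
Qed.

(** Two distinct attachments give a theta with [T = [:: u]]. Its arcs avoid [V]; if they also avoid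
    the neighbours of [u], then [x1 - u - v] is a clean tail. Otherwise a second neighbour [xr] of
    [u] leads to a cycle through [u] and all of [c]. *)
Lemma attached_unique x0 y0 : x0 \in c -> y0 \in c ->
  adj u x0 -> link (u :: c) u y0 -> x0 = y0.
Proof.
move=> cx0 cy0 ux0 Vy0; apply/eqP; apply: contraT => nx0y0; exfalso.
have [_ /andP[cyc_c uc]] := c_cycle.
have [v uv vV] : exists2 v, adj u v & forall w, adj v w -> link (u :: c) u w.
  have [v [s [/= /andP[uv _] _ _ /norP[vF _]]]] := linkP _ _ _ Vy0.
  exists v => // w vw; apply/existsP; exists v; apply/existsP; exists v.
  by rewrite uv vF connect0.
set V := link (u :: c) u in Vy0 vV.
have [i s Es] := rot_to cy0.
have eqc : perm_eq c (y0 :: s) by rewrite -Es perm_sym perm_rot.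
have cyc_s : cycle (@adj G) (y0 :: s) by rewrite -Es rot_cycle.
(* [x1] is a neighbour of [u] such that [A], the arc from [x1] to the next vertex
   of [V], contains no neighbour of [u]. The arc [B] from the previous vertex of
   [V] to [x1] may contain some; [xr] is the first one. *)
have /split_last[s1 [x1 [s2 [Es12 ux1 U's2]]]] : has (adj u) s.
  by apply/hasP; exists x0 => //; move: cx0; rewrite (perm_mem eqc) inE (negPf nx0y0).
(* The default [y0] matters: if [s2] misses [V], the arc runs up to [y0], where the cycle was cut
   open. *)
have [A [Qa [EA V'A VQa]]] : exists A Qa, [/\ s2 = A ++ Qa, ~~ has V A & V (head y0 Qa)].
  have [/split_first[A [y [R [-> Vy V'A]]]]|V's2] := boolP (has V s2).
    by exists A, (y :: R).
  by exists s2, [::]; rewrite cats0.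
have [Qb [B [EB V'B VQb]]] : exists Qb B, [/\ s1 = Qb ++ B, ~~ has V B & V (last y0 Qb)].
  have [/split_last[R [y [B [-> Vy V'B]]]]|V's1] := boolP (has V s1).
    by exists (rcons R y), B; rewrite cat_rcons last_rcons.
  by exists [::], s1.
pose Q := Qa ++ y0 :: Qb.
have Q0 : Q != [::] by rewrite /Q; case: (Qa).
have hQ z : head z Q = head y0 Qa by rewrite /Q; case: (Qa).
have lQ z : last z Q = last y0 Qb by rewrite /Q last_cat.
have {Es12 s1 s2 EA EB U's2} [U'A eqF cyc] : [/\ ~~ has (adj u) A,
    perm_eq (u :: c) (u :: x1 :: A ++ Q ++ B) & cycle (@adj G) (x1 :: A ++ Q ++ B)].
  split; first by move: U's2; rewrite EA has_cat => /norP[].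
    by rewrite perm_cons (perm_trans eqc) // Es12 EA EB /Q; perm_lia.
  move: cyc_s; rewrite Es12 EA EB -cat_cons cycle_catC /Q.
  by rewrite -!catA /= -?catA.
have thetaI z A' B' T : perm_eq (z :: A' ++ Q ++ B' ++ T) (u :: x1 :: A ++ Q ++ B) ->
    cycle (@adj G) (z :: A' ++ Q ++ B') -> path (@adj G) z T -> last z T = u ->
    theta z A' Q B' T.
  move=> eqF' *; apply: attached_theta; rewrite ?hQ ?lQ //.
  by rewrite (perm_trans eqF') // perm_sym.
have clean z A' B' : adj z u -> ~~ has (adj u) (A' ++ B') -> ~~ has V (A' ++ B') ->
    clean_tail z u v (A' ++ B').
  move=> zu U'S V'S; split=> // w Sw; rewrite (hasPn U'S w Sw) /=.
  by apply: contra (hasPn V'S w Sw); apply: vV.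
have x1u : adj x1 u by rewrite adj_sym.
have th1 : theta x1 A Q B [:: u].
  by apply: thetaI; rewrite /= ?x1u //; perm_lia.
have [hU|U'B] := boolP (has (adj u) B); last first.
  apply: (theta_absurd th1 (clean _ _ _ x1u _ _)).
    by rewrite has_cat negb_or U'A.
  by rewrite has_cat negb_or V'A.
have [B' [xr [M [EB uxr U'B']]]] := split_first hU.
have xru : adj xr u by rewrite adj_sym.
subst B; have V'B' : ~~ has V B' by move: V'B; rewrite has_cat => /norP[].
have th2 : theta xr (M ++ x1 :: A) Q B' [:: u].
  apply: thetaI; rewrite ?path1 //; first by perm_lia.
    by move: cyc; path_auto.
  by rewrite /= xru.
have {th1} A1 := theta_arc th1.
have {th2} := theta_arc (theta_rev th2); rewrite size_rev => B1.
case/lastP: M => [|M x] in V'B thetaI cyc eqF hU.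
  have : adj xr x1 by move: cyc; path_auto.
  by apply/negP/(triangleG xru).
case: A => [|a A] // in V'A U'A thetaI cyc eqF A1.
case/lastP: B' => [|B b] // in U'B' V'B V'B' thetaI cyc eqF hU B1.
have [x1a [bxr xx1]] : adj x1 a /\ adj b xr /\ adj x x1 by move: cyc; path_auto.
have xrb : adj xr b by rewrite adj_sym.
have x1x : adj x1 x by rewrite adj_sym.
have pM : path (@adj G) xr (rcons M x) by move: cyc; path_auto.
have pM' : path (@adj G) x (rcons (rev M) xr) by rewrite -path_rcons_sym.
have vV' w : ~~ V w -> adj v w = false by move=> /negP nVw; apply/negP => /vV.
have va : adj v a = false by apply/vV'; case/norP: V'A.
have vb : adj v b = false by apply/vV'; move: V'B'; rewrite has_rcons => /norP[].
have vx : adj v x = false.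
  by apply/vV'; move: V'B; rewrite has_cat /= !has_rcons => /norP[_ /norP[_ /norP[]]].
have ub : adj u b = false by apply/negbTE; move: U'B'; rewrite has_rcons => /norP[].
have U'AB : ~~ has (adj u) ((a :: A) ++ rcons B b) by rewrite has_cat negb_or U'A.
have V'AB : ~~ has V ((a :: A) ++ rcons B b) by rewrite has_cat negb_or V'A.
(* With this edge the cycle could skip [M] and [xr], which move into the path from [x1] to [u]; the
   arcs left contain no neighbour of [u]. *)
have nbx1 : ~~ adj b x1.
  apply/negP => bx1; pose T := rev (rcons M x) ++ [:: xr; u].
  have th : theta x1 (a :: A) Q (rcons B b) T.
    apply: thetaI; rewrite /T ?last_cat //; first by perm_lia.
      by move: cyc bx1; path_auto.
    by move: pM'; rewrite rev_rcons; path_auto.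
  exact: theta_absurd th (clean _ _ _ x1u U'AB V'AB).
have naxr : ~~ adj a xr.
  apply/negP; rewrite adj_sym => xra; pose T := rcons M x ++ [:: x1; u].
  have th : theta xr (a :: A) Q (rcons B b) T.
    apply: thetaI; rewrite /T ?last_cat //; first by perm_lia.
      by move: cyc; path_auto.
    by move: pM; path_auto.
  exact: theta_absurd th (clean _ _ _ xru U'AB V'AB).
(* Spider with centre [u], legs [x1 - a] and [xr - b], and leaf [v]; the next one has centre [x1],
   legs [u - v] and [a - b], and leaf [x]. *)
have ab : adj a b.
  have := spider_free spiderG triangleG ux1 uxr uv x1a xrb.
  by rewrite (negPf naxr) (negPf nbx1) ![adj _ v]adj_sym va vb.
have bx : adj b x.
  have := spider_free spiderG triangleG x1u x1a x1x uv ab.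
  by rewrite va vx vb [adj b u]adj_sym ub !orbF.
pose C := (x1 :: (a :: A) ++ Q ++ rcons B b) ++ rev (rcons M x) ++ [:: xr; u].
have /negP[] : ~~ cycle (@adj G) C.
  apply: (@no_long_cycle _ [::] (u :: c)) => /=; rewrite ?uNc ?size_c ?addn0 //.
  by rewrite (perm_trans eqF) // /C; perm_lia.
by move: cyc pM' bx; rewrite /C rev_rcons; path_auto.
Qed.

End Attached.
End Circumference.

(** * Longest cycles and 2-connectedness *)

Lemma cycle_longest : (exists c, is_cycle c) -> exists c, longest_cycle c.
Proof.
pose P n := (2 < n) && [exists t : n.-tuple G, ucycleb (@adj G) t].
have PP c : is_cycle c -> P (size c).
  case=> c2 uc; rewrite /P c2; apply/existsP; exists (in_tuple c).
  exact: uc.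
have exP : (exists c, is_cycle c) -> exists n, P n by case=> c /PP; exists (size c).
have leP n : P n -> n <= #|G|.
  case/andP=> _ /existsP[t /andP[_ /card_uniqP Et]].
  by have := max_card (mem (tval t)); rewrite Et size_tuple.
move=> /exP{}exP; have [n /andP[n2 /existsP[t ut]] max_n] := ex_maxnP exP leP.
exists t; split; first by split; [rewrite size_tuple | exact: ut].
by move=> c /PP/max_n; rewrite size_tuple.
Qed.

Section TwoConnected.

Hypothesis G2 : k_connected 2 G.

Lemma path_avoiding (t a b : G) : a != t -> b != t ->
  exists p, [/\ path (@adj G) a p, last a p = b & t \notin a :: p].
Proof.
move=> at_ bt; have [|_ conn] := (proj2 G2) [set t]; first by rewrite cards1.
have aX : a \in ~: [set t] by rewrite !inE.
have bX : b \in ~: [set t] by rewrite !inE.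
pose a' : induced (~: [set t]) := exist _ a aX.
pose b' : induced (~: [set t]) := exist _ b bX.
have /connectP[p p_p lb] := conn a' b'.
exists (map val p); split.
- by rewrite -[a]/(val a') path_map.
- by rewrite -[a]/(val a') last_map -lb.
rewrite -[a :: _]/(map val (a' :: p)); apply/mapP=> -[x _ tx].
by have := valP x; rewrite -tx !inE eqxx.
Qed.

(** Follow a path that avoids [t] until it first meets [c]. *)
Lemma exit_avoiding (c : seq G) (t h : G) : h \notin c -> h != t ->
    (exists2 w, w \in c & w != t) ->
  exists g w, [/\ connect (adj_off c) h g, g != t, adj g w, w \in c & w != t].
Proof.
move=> hNc ht [w cw wt]; have [p [p_p lw tp]] := path_avoiding ht wt.
elim: p h hNc ht p_p lw tp => [|x p IHp] h hNc ht /=.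
  by move=> _ hw; rewrite -hw (negPf hNc) in cw.
case/andP=> hx p_p lw; rewrite inE negb_or => /andP[_ tp].
have xt : x != t by move: tp; rewrite inE negb_or eq_sym => /andP[].
have [cx|xNc] := boolP (x \in c); first by exists h, x.
have [g [w' [xg gt gw cw' wt']]] := IHp x xNc xt p_p lw tp.
exists g, w'; split=> //; apply: connect_trans xg; apply: connect1.
exact/andP.
Qed.

(** A [link] needs an inner vertex, so two exits with distinct ends both off and on [c] are sought.
    If the exits to [x1] and [x2] both leave from [g1], a third one, starting at [h] or [h'] and
    avoiding [g1], pairs with one of them. *)
Lemma component_attached (c : seq G) (h h' : G) :
    is_cycle c -> adj h h' -> h \notin c -> h' \notin c ->
  exists u x y, [/\ u \notin c, x \in c, y \in c, x != y &
                       adj u x && link (u :: c) u y].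
Proof.
move=> [c2 /andP[_ uc]] hh' hNc h'Nc.
have off_sym a b : a \notin c -> connect (adj_off c) a b ->
   (b \notin c) && connect (adj_off c) b a.
  move=> aNc /connectP[p + ->]; elim: p a aNc => /= [|x p IHp] a aNc.
    by rewrite aNc connect0.
  case/andP=> /andP[ax xNc] /(IHp x xNc)/andP[-> xa]; apply: connect_trans xa _.
  by apply: connect1; rewrite /adj_off /= adj_sym ax.
have join g g' x y : connect (adj_off c) h g -> connect (adj_off c) h g' ->
    g != g' -> adj g x -> adj g' y -> x \in c -> y \in c -> x != y ->
    exists u x y, [/\ u \notin c, x \in c, y \in c, x != y &
                       adj u x && link (u :: c) u y].
  move=> hg hg' gg' gx gy cx cy xy; have /andP[gNc gh] := off_sym _ _ hNc hg.
  exists g, x, y; split; rewrite // gx /=; apply/linkP.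
  have /connectP[p0 p_p0 Eg'] := connect_trans gh hg'.
  case/shortenP: p_p0 Eg' => -[|v p] p_p up _ Eg'; first by rewrite Eg' eqxx in gg'.
  exists v, p; split.
  - by apply: sub_path p_p => a b /andP[].
  - by rewrite -[last v p]/(last g (v :: p)) -Eg'.
  - by case/andP: up.
  have poff : all (fun a => a \notin c) (v :: p).
    elim: (v :: p) g p_p {up gNc gh gx hg gg' Eg'} => //= b q IHq g.
    by case/andP=> /andP[_ ->] /IHq.
  apply/hasPn=> a pa; rewrite inE negb_or (allP poff) // andbT.
  by apply: contraTneq pa => ->; case/andP: up.
have other t : exists2 w, w \in c & w != t.
  case: c c2 uc {hNc h'Nc off_sym join} => [|a [|b c]] // _ /= /andP[ab _].
  have [at_|] := eqVneq a t; last by exists a; rewrite ?mem_head.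
  exists b; first by rewrite !inE eqxx orbT.
  by move: ab; rewrite -at_ inE negb_or eq_sym => /andP[].
have hc x : x \in c -> h != x by apply: contraTneq => <-.
have [w0 cw0 _] := other h.
have [g1 [x1 [hg1 _ g1x cx1 _]]] := exit_avoiding hNc (hc _ cw0) (other w0).
have [g2 [x2 [hg2 _ g2x cx2 x21]]] := exit_avoiding hNc (hc _ cx1) (other x1).
have [Eg|ng] := eqVneq g1 g2; last by apply: join hg1 hg2 ng g1x g2x cx1 cx2 _; rewrite eq_sym.
have [k [hk kNc kg]] : exists k, [/\ connect (adj_off c) h k, k \notin c & k != g1].
  have [<-|hg] := eqVneq h g1; last by exists h.
  exists h'; split=> //; last by rewrite eq_sym; apply: adj_neq.
  by apply: connect1; apply/andP.
have [g3 [x3 [kg3 g31 g3x cx3 _]]] := exit_avoiding kNc kg (other g1).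
have hg3 := connect_trans hk kg3.
have [Ex|nx] := eqVneq x3 x1.
  by apply: join hg3 hg2 _ g3x g2x cx3 cx2 _; rewrite -?Eg // Ex eq_sym.
by apply: join hg3 hg1 g31 g3x g1x cx3 cx1 nx.
Qed.

Lemma third_vertex (a b : G) : exists2 t, t != a & t != b.
Proof.
have /set0Pn[t] : ~: [set a; b] != set0.
  rewrite -card_gt0 cardsCs setCK subn_gt0; apply: leq_ltn_trans (proj1 G2).
  by rewrite cards2; case: (a != b).
by rewrite !inE negb_or => /andP[]; exists t.
Qed.

Lemma exists_neighbor (a t : G) : a != t -> exists2 b, adj a b & b != t.
Proof.
move=> at_; have [b ba bt] := third_vertex a t.
have [[|x p] /= [p_p lb tp]] := path_avoiding at_ bt; first by rewrite lb eqxx in ba.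
case/andP: p_p => ax _; exists x => //.
by move: tp; rewrite !inE !negb_or eq_sym => /and3P[_ xt _]; rewrite eq_sym.
Qed.

(** A path between two neighbours of [x] that avoids [x] closes up through [x]. *)
Lemma exists_cycle : exists c, is_cycle c.
Proof.
have [x _] : exists x : G, x \in G by apply/card_gt0P/(leq_trans _ (proj1 G2)).
have [t tx _] := third_vertex x x.
have [|a xa _] := @exists_neighbor x t; first by rewrite eq_sym.
have [b xb ba] := exists_neighbor (adj_neq xa).
have ax : a != x by rewrite eq_sym adj_neq.
have bx : b != x by rewrite eq_sym adj_neq.
have [p0 [p_p0 lb xp0]] := path_avoiding ax bx.
case/shortenP: p_p0 lb => p p_p up p_sub lb; exists (x :: a :: p).
have p0_gt0 : 0 < size p by case: (p) lb => //= ab; rewrite ab eqxx in ba.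
split=> //; apply/andP; split.
  by rewrite /= rcons_path xa p_p lb adj_sym.
rewrite cons_uniq up andbT; apply: contra xp0; rewrite !inE.
by case/orP=> [->//|/p_sub->]; rewrite orbT.
Qed.

(** * Graphs with a triangle *)

Lemma adj_ind (P : pred G) (a : G) :
  P a -> (forall x y, adj x y -> P x -> P y) -> forall b, P b.
Proof.
move=> Pa Pstep b; have [t ta tb] := third_vertex a b.
rewrite ![t == _]eq_sym in ta tb; have [p [p_p <- _]] := path_avoiding ta tb.
elim: p a Pa p_p {t ta tb} => //= x p IHp a Pa /andP[ax]; apply: IHp.
exact: Pstep Pa.
Qed.

(** A pendant edge at a triangle lies in a triangle itself, so by connectedness every edge does.
    Domination of a fixed edge then spreads from a vertex to its neighbours. *)
Lemma edge_dominates (a0 b0 c0 : G) : free_of Z1 G ->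
    adj a0 b0 -> adj b0 c0 -> adj a0 c0 ->
  forall x y w : G, adj x y -> adj w x || adj w y.
Proof.
move=> paw ab bc ac.
pose in_triangle x := [exists y, [exists z, [&& adj x y, adj y z & adj x z]]].
have edge_triangle x y : adj x y -> in_triangle x -> exists2 t, adj x t & adj y t.
  move=> xy /existsP[p /existsP[q /and3P[xp pq xq]]].
  have := @paw_free p q x y paw pq.
  rewrite ![adj _ x]adj_sym [adj p y]adj_sym [adj q y]adj_sym.
  by case/(_ xq xp xy)/orP; [exists p | exists q].
have all_triangle : forall x, in_triangle x.
  apply: (@adj_ind _ a0) => [|x y xy x_tri].
    by apply/existsP; exists b0; apply/existsP; exists c0; rewrite ab bc.
  have [t xt yt] := edge_triangle x y xy x_tri.
  by apply/existsP; exists x; apply/existsP; exists t; rewrite adj_sym xy xt.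
have step (a c w b : G) : adj a c -> adj w b -> adj w a -> adj b a || adj b c.
  move=> a_c wb wa; rewrite ![adj b _]adj_sym.
  (* If [w] misses [c], the common neighbour [t] of [w] and [a] is adjacent to [c], and the triangle
     [a c t] can replace [a c w]. *)
  have [t wt at_] := edge_triangle _ _ wa (all_triangle w).
  have [wc|wc] := boolP (adj w c).
    by apply: (@paw_free a c w b) => //; rewrite adj_sym.
  have tc : adj t c.
    have := @paw_free w t a c paw wt _ wa a_c.
    by rewrite (negPf wc) [adj t a]adj_sym; apply.
  have /orP[tb|->//] : adj t b || adj a b.
    by apply: (@paw_free t a w b) => //; rewrite adj_sym.
  by apply: (@paw_free a c t b) => //; rewrite adj_sym.
move=> x y w xy; move: w; apply: (@adj_ind _ x) => [|w b wb].
  by rewrite xy orbT.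
case/orP=> [wx|wy]; first exact: step wb wx.
by rewrite orbC; apply: step wb wy; rewrite adj_sym.
Qed.

End TwoConnected.

(* Otherwise the edge [u v] fits between the first two vertices of [c]. *)
Lemma edge_meets_longest (c : seq G) (u v : G) : longest_cycle c ->
    (forall x y w : G, adj x y -> adj w x || adj w y) ->
  adj u v -> (u \in c) || (v \in c).
Proof.
move=> [[c2 /andP[cyc uc]] c_max] dom uv; apply: contraT => /norP[uNc vNc].
case: c c2 uc cyc c_max uNc vNc => [|x [|y c]] // _ uc /= /andP[xy cyc] c_max.
rewrite !inE !negb_or => /and3P[ux uy uNc] /and3P[vx vy vNc].
have long a b : perm_eq [:: a; b] [:: u; v] -> adj x a -> adj a b -> adj b y -> False.
  move=> eq_ab xa ab b_y.
  have /c_max : is_cycle [:: x, a, b, y & c]; last by rewrite /= !ltnS ltnNge leqnSn.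
  split=> //; apply/andP; split; first by rewrite /= xa ab b_y.
  have eqF : perm_eq [:: x, a, b, y & c] ([:: x, y & c] ++ [:: u; v]).
    by apply/permP=> P; move: (permP eq_ab P); rewrite /= count_cat /=; clear; lia.
  rewrite (perm_uniq eqF) cat_uniq uc /= !inE !negb_or (adj_neq uv).
  by rewrite ux uy uNc vx vy vNc.
have vu : adj v u by rewrite adj_sym.
have perm_vu : perm_eq [:: v; u] [:: u; v] by apply/permP=> P /=; rewrite addnCA.
exfalso; have [xu|xu] := boolP (adj x u).
  have [v_y|v_y] := boolP (adj v y); first exact: long xu uv v_y.
  have := dom _ _ v xy; rewrite (negPf v_y) orbF => v_x.
  have := dom _ _ y uv; rewrite [adj y v]adj_sym (negPf v_y) orbF => y_u.
  by apply: (long v u perm_vu) => //; rewrite adj_sym.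
have := dom _ _ x uv; rewrite (negPf xu) /= => xv.
have := dom _ _ u xy; rewrite [adj u x]adj_sym (negPf xu) /= => u_y.
exact: long xv vu u_y.
Qed.

End Graph.

Theorem theorem5 (G : sgraph) :
  k_connected 2 G -> free_of K13_starstar G -> free_of Z1 G ->
  exists c : seq G, longest_cycle c /\ dominating_cycle c.
Proof.
move=> G2 spiderG pawG; have [c c_long] := cycle_longest (exists_cycle G2).
have [c_cycle c_max] := c_long; exists c; do 2!split=> //; move=> u v uv.
have [tri|] := boolP [forall x : G, forall y : G, forall z : G,
                        adj x y ==> adj y z ==> ~~ adj x z].
  have triG : triangle_free G.
    by move=> x y z xy yz; move/forallP/(_ x)/forallP/(_ y)/forallP/(_ z): tri; rewrite xy yz.
  apply: contraT => /norP[uNc vNc].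
  have [w [x [y [wNc cx cy + /andP[wx wy]]]]] := component_attached G2 c_cycle uv uNc vNc.
  have -> := attached_unique (proj1 c_cycle) c_max triG spiderG c_cycle erefl wNc cx cy wx wy.
  by rewrite eqxx.
case/forallPn=> x /forallPn[y /forallPn[z]]; rewrite 2!negb_imply negbK.
case/and3P=> xy yz xz; apply: edge_meets_longest c_long _ uv.
exact: (edge_dominates G2 pawG xy yz xz).
Qed.
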